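(* Let $a$ and $b$ be distinct primes. Then the complete tripartite graph $K_{ab,ab,a}$ is $S$-determined if and only if $(a,b)\ne(2,3)$.
   Context: All graphs are finite and simple. For a graph $G$, the Seidel matrix is $S(G)=J-I-2A(G)$, where $A(G)$ is the adjacency matrix, $J$ the all-ones matrix and $I$ the identity; its eigenvalue multiset is the Seidel spectrum of $G$. For a partition $V(G)=U\cup W$, Seidel switching with respect to $U$ deletes all edges between $U$ and $W$ and adds an edge between $u\in U$, $w\in W$ whenever $uw$ was not an edge. Two graphs are switching equivalent if one is obtained from the other by a Seidel switching. A graph $G$ is $S$-determined if every graph with the same Seidel spectrum as $G$ is switching equivalent to a graph isomorphic to $G$. *)

(* Defs.v *)
From HB Require Import structures.
From mathcomp Require Import all_boot all_order all_algebra all_field.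

Set Implicit Arguments.
Unset Strict Implicit.
Unset Printing Implicit Defensive.

Import GRing.Theory.
Local Open Scope ring_scope.

Record sgraph (T : finType) := SGraph {
  adj : rel T;
  adj_sym : symmetric adj;
  adj_irr : irreflexive adj
}.

Definition adjmx (T : finType) (G : sgraph T) : 'M[algC]_#|T| :=
  \matrix_(i, j) (adj G (enum_val i) (enum_val j))%:R.

Definition seidelmx (T : finType) (G : sgraph T) : 'M[algC]_#|T| :=
  const_mx 1 - 1%:M - 2%:R *: adjmx G.

(* The eigenvalues listed with algebraic multiplicity, in unspecified order:
   a sequence to be compared up to perm_eq. Seidel matrices are integral, so
   all their eigenvalues lie in algC; they are also real symmetric, so algebraic
   and geometric multiplicities agree. *)
Definition spectrum (n : nat) (A : 'M[algC]_n) : seq algC :=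
  sval (closed_field_poly_normal (char_poly A)).

Definition seidel_spectrum (T : finType) (G : sgraph T) : seq algC :=
  spectrum (seidelmx G).

Definition same_seidel_spectrum (T T' : finType)
    (G : sgraph T) (H : sgraph T') : Prop :=
  perm_eq (seidel_spectrum G) (seidel_spectrum H).

Section Switching.
Variables (T : finType) (G : sgraph T) (U : {set T}).

Definition switch_rel : rel T :=
  fun x y => if (x \in U) == (y \in U) then adj G x y else ~~ adj G x y.

Lemma switch_sym : symmetric switch_rel.
Proof. by move=> x y; rewrite /switch_rel eq_sym (adj_sym G x y). Qed.

Lemma switch_irr : irreflexive switch_rel.
Proof. by move=> x; rewrite /switch_rel eqxx (adj_irr G x). Qed.

Definition switch : sgraph T := SGraph switch_sym switch_irr.
End Switching.

(* Switching with respect to U is an involution, so this relation is symmetric. *)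
Definition switching_equivalent (T : finType) (G H : sgraph T) : Prop :=
  exists U : {set T}, adj H =2 adj (switch G U).

Definition isomorphic (T T' : finType)
    (G : sgraph T) (H : sgraph T') : Prop :=
  exists2 f : T -> T', bijective f & forall x y, adj H (f x) (f y) = adj G x y.

Definition S_determined (T : finType) (G : sgraph T) : Prop :=
  forall (T' : finType) (H : sgraph T'),
    same_seidel_spectrum H G ->
    exists2 K : sgraph T', switching_equivalent H K & isomorphic K G.

Section CompleteTripartite.
Variables p q r : nat.

Definition tripart (x : 'I_p + 'I_q + 'I_r) : nat :=
  match x with inl (inl _) => 0 | inl (inr _) => 1 | inr _ => 2 end%N.

Definition tripart_rel : rel ('I_p + 'I_q + 'I_r)%type :=
  fun x y => tripart x != tripart y.

Lemma tripart_sym : symmetric tripart_rel.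
Proof. by move=> x y; rewrite /tripart_rel eq_sym. Qed.

Lemma tripart_irr : irreflexive tripart_rel.
Proof. by move=> x; rewrite /tripart_rel eqxx. Qed.

Definition complete_tripartite : sgraph ('I_p + 'I_q + 'I_r)%type :=
  SGraph tripart_sym tripart_irr.
End CompleteTripartite.

(* Main.v *)
Require Import Defs.
From HB Require Import structures.
From mathcomp Require Import all_boot all_order all_algebra all_field.
From mathcomp Require Import perm spectral ring zify.

(** Put [B := S + I = J - 2 A], a symmetric sign matrix with unit diagonal. For
    [K_{p,q,r}], or any switching of it, [B] factors through a [3 x 3] matrix,
    and its characteristic polynomial is
    [X^(n-3) (X^3 - n X^2 + 4 p q r)] with [n = p + q + r]. So two complete
    tripartite graphs are cospectral iff their parts have the same sum and the
    same product.

    A graph cospectral with [K_{p,q,r}], where [p q r > 0], has [B] of rank at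
    most [3], by the spectral theorem. Take three vertices whose sign product
    is [-1]; their rows then span all the rows, and the condition
    [B u u = 1] forces every row to agree up to sign with one of the three: the
    graph is a switching of a complete tripartite graph. (If there are no such
    vertices, it is a switching of the empty graph.)

    It remains to solve [x + y + z = 2 a b + a], [x y z = a^3 b^2]. All three
    unknowns have the form [a^i b^j]; the only solution other than
    [(ab, ab, a)] is [(a^3, b, b)] with [a (a + 1) = 2 b], that is [a = 2],
    [b = 3], and [K_{8,3,3}] is cospectral with [K_{6,6,2}]. These two are not
    related by switching, as switching preserves sign products of triples and
    these determine the parts. *)

Set Implicit Arguments.
Unset Strict Implicit.
Unset Printing Implicit Defensive.

Section SeidelSpectrum.
Import GRing.Theory Num.Theory.
Local Open Scope ring_scope.

(** * Determinants of products and ranks of normal matrices *)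

(** Sylvester's identity without division: a block-triangular factor on the right or on the left of
    [M] clears its lower left block. *)
Lemma det_scalar_sub_mulmxC (R : comPzRingType) (m n : nat) (l : R)
    (A : 'M[R]_(m, n)) (B : 'M[R]_(n, m)) :
  l ^+ n * \det (l%:M - A *m B) = l ^+ m * \det (l%:M - B *m A).
Proof.
pose M := block_mx l%:M A B 1%:M.
have detM : \det M = \det (l%:M - A *m B).
  have : M *m block_mx 1%:M 0 (- B) 1%:M = block_mx (l%:M - A *m B) A 0 1%:M.
    by rewrite mulmx_block !mulmx1 !mulmx0 !add0r mul1mx mulmxN subrr.
  by move/(congr1 determinant);
    rewrite det_mulmx det_lblock det_ublock !det1 !mulr1.
have : block_mx 1%:M 0 (- B) l%:M *m M = block_mx l%:M A 0 (l%:M - B *m A).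
  rewrite mulmx_block !mul1mx !mul0mx !addr0 mulmx1 mulNmx mulNmx.
  by rewrite mul_mx_scalar mul_scalar_mx addNr addrC.
move/(congr1 determinant).
by rewrite det_mulmx det_lblock det_ublock det1 mul1r !det_scalar -detM.
Qed.

Lemma char_poly_mulmxC (F : fieldType) (n : nat) (A B : 'M[F]_n) :
  char_poly (A *m B) = char_poly (B *m A).
Proof.
have Xn0 : 'X^n != 0 :> {poly F} by rewrite expf_neq0 ?polyX_eq0.
by apply: (mulfI Xn0);
  rewrite /char_poly /char_poly_mx !map_mxM det_scalar_sub_mulmxC.
Qed.

Lemma mxrank_diag_mx (F : fieldType) (n : nat) (d : 'rV[F]_n) :
  (\rank (diag_mx d) <= #|[pred i | d 0%R i != 0%R]|)%N.
Proof.
have -> : diag_mx d = \sum_(i | d 0 i != 0) d 0 i *: delta_mx i i.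
  rewrite diag_mx_sum_delta (bigID (fun i => d 0 i != 0)) /= [X in _ + X]big1
    ?addr0 //.
  by move=> i /negPn/eqP->; rewrite scale0r.
rewrite -sum1_card.
apply: (big_ind2 (fun (A : 'M_n) k => (\rank A <= k)%N)).
- by rewrite mxrank0.
- move=> A k B l hA hB; exact: leq_trans (mxrank_add _ _) (leq_add hA hB).
- move=> i di; rewrite (leq_trans (mxrankS (scalemx_sub _ (submx_refl _)))) //.
  by rewrite mxrank_delta.
Qed.

(** By the spectral theorem the rank is at most the number of eigenvalues other than [x]. Powers of
    ['X - x%:P] stand on both sides to avoid the truncated exponent [n - k]. *)
Lemma normalmx_rank_sub (C : numClosedFieldType) (n k : nat) (A : 'M[C]_n)
    (x : C) (q : {poly C}) :
  A \is normalmx -> q.[x] != 0 ->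
  ('X - x%:P) ^+ k * char_poly A = ('X - x%:P) ^+ n * q ->
  (\rank (A - x%:M)%R <= k)%N.
Proof.
move=> /orthomx_spectralP; set P := spectralmx A; set d := spectral_diag A.
have uP : P \in unitmx := spectral_unit A.
move=> AE qx0 chA.
have chd : char_poly A = \prod_(i < n) ('X - (d 0 i)%:P).
  rewrite AE -mulmxA char_poly_mulmxC mulmxK // char_poly_trig
    ?diag_mx_is_trig //.
  by apply: eq_bigr => i _; rewrite mxE eqxx.
have -> : A - x%:M = invmx P *m diag_mx (d - const_mx x) *m P.
  rewrite raddfB /= mulmxBr mulmxBl -AE; congr (_ - _).
  by rewrite diag_const_mx mul_mx_scalar -scalemxAl mulVmx // scalemx1.
apply: leq_trans (mxrankM_maxl _ _) _; apply: leq_trans (mxrankM_maxr _ _) _.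
apply: leq_trans (mxrank_diag_mx _) _.
rewrite (eq_card (B := [pred i | d 0 i != x])); last first.
  by move=> i; rewrite !inE !mxE subr_eq0.
(* If more than [k] eigenvalues differed from [x], cancelling [k + m'] factors ['X - x%:P] would
   leave such factors on the right only, and evaluation at [x] would make a nonzero product
   vanish. *)
set m := #|_|; rewrite leqNgt; apply/negP => lt_km.
have cardE : (m + #|[pred i | d 0%R i == x]| = n)%N.
  by rewrite -[RHS]card_ord -(cardC [pred i | d 0 i != x]); congr addn;
    apply: eq_card => i; rewrite !inE negbK.
set m' := #|_| in cardE.
move: chA; rewrite chd (bigID (fun i => d 0 i == x)) /=.
under eq_bigr => i /eqP-> do [].
rewrite prodr_const -/m' mulrA -exprD => /esym.
have nE : n = ((k + m') + (n - (k + m')))%N by lia.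
rewrite [X in _ ^+ X * q]nE exprD -mulrA => /mulfI E.
have {E} E := E (expf_neq0 _ (negbT (polyXsubC_eq0 _))).
move: (congr1 (horner^~ x) E);
  rewrite hornerM horner_exp hornerXsubC subrr expr0n.
have -> : (n - (k + m') == 0)%N = false by lia.
rewrite mul0r horner_prod => /esym/eqP/prodf_eq0[i di].
by rewrite hornerXsubC subr_eq0 eq_sym (negPf di).
Qed.

(** * Characteristic polynomial of a tripartition *)

Lemma det_mx33 (R : comPzRingType) (A : 'M[R]_3) :
  \det A = A 0 0 * (A 1 1 * A 2%:R 2%:R - A 1 2%:R * A 2%:R 1)
         - A 0 1 * (A 1 0 * A 2%:R 2%:R - A 1 2%:R * A 2%:R 0)
         + A 0 2%:R * (A 1 0 * A 2%:R 1 - A 1 1 * A 2%:R 0).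
Proof.
pose f (k l : nat) : R := A (inord k) (inord l).
have fE i j : A i j = f i j by rewrite /f !inord_val.
rewrite (expand_det_row _ 0) !big_ord_recl big_ord0 /cofactor.
rewrite !(expand_det_row _ 0) !big_ord_recl !big_ord0 /cofactor !det_mx11.
rewrite !mxE !fE /= /bump /=; ring.
Qed.

(* [H] is the switching, with respect to the set [s], of the complete tripartite
   graph whose (possibly empty) parts are the fibers of [c]. *)
Definition tripartition (T : finType) (H : sgraph T) (s : T -> bool)
    (c : T -> 'I_3) : Prop :=
  forall u v, adj H u v = s u (+) s v (+) (c u != c v).

Lemma seidelmxE (T : finType) (H : sgraph T) i j :
  seidelmx H i j = (-1) ^+ adj H (enum_val i) (enum_val j) - (i == j)%:R.
Proof.
by rewrite !mxE; case: (adj H _ _); rewrite ?expr0 ?expr1 /=; ring.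
Qed.

Lemma card_sum_fibers (I T : finType) (c : T -> I) :
  #|T| = (\sum_i #|[pred u | c u == i]|)%N.
Proof.
rewrite -sum1_card (partition_big c xpredT) //=.
by apply: eq_bigr => i _; rewrite sum1_card.
Qed.

(** Here [S + I = U M U^T], with [U] the signed indicators of the fibers and [M] having 1 on and -1
    off the diagonal. Swapping factors leaves a 3 x 3 determinant in [X + 1]: its linear term
    vanishes with the principal 2 x 2 minors of [M], and the 4 is [- det M]. *)
Lemma char_poly_seidel (T : finType) (H : sgraph T) (s : T -> bool)
    (c : T -> 'I_3) : tripartition H s c ->
  ('X + 1) ^+ 3 * char_poly (seidelmx H) =
  ('X + 1) ^+ #|T| * (('X + 1) ^+ 3 - #|T|%:R * ('X + 1) ^+ 2 +
    (4 * \prod_(i < 3) #|[pred u | c u == i]|)%:R).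
Proof.
move=> sc.
pose U : 'M[{poly algC}]_(#|T|, 3) :=
  \matrix_(i, k) ((-1) ^+ s (enum_val i) *+ (c (enum_val i) == k)).
pose M : 'M[{poly algC}]_3 := \matrix_(k, l) (-1) ^+ (k != l).
have MUE k j : (M *m U^T) k j = (-1) ^+ (k != c (enum_val j))
    * (-1) ^+ s (enum_val j).
  rewrite !mxE (bigD1 (c (enum_val j))) //= big1 ?addr0 => [|l /negPf nl].
    by rewrite !mxE eqxx mulr1n.
  by rewrite !mxE [c _ == l]eq_sym nl mulr0n mulr0.
have -> : char_poly (seidelmx H) = \det (('X + 1)%:M - U *m (M *m U^T)).
  congr (\det _); apply/matrixP => i j.
  have -> : char_poly_mx (seidelmx H) i j =
      'X *+ (i == j) - (seidelmx H i j)%:P.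
    by rewrite /char_poly_mx; move: (seidelmx H) => S; rewrite !mxE.
  rewrite seidelmxE sc [in RHS]mxE [X in _ = X + _]mxE [X in _ = _ + X]mxE.
  rewrite mxE (bigD1 (c (enum_val i))) //= big1 ?addr0 => [|l /negPf nl];
    last first.
    by rewrite mxE eq_sym nl mulr0n mul0r.
  rewrite MUE mxE eqxx mulr1n.
  rewrite raddfB /= rmorphXn /= rmorphN1 rmorph_nat !signr_addb.
  by case: (i == j); rewrite ?mulr1n ?mulr0n; ring.
have MUU k l : (M *m U^T *m U) k l =
    (-1) ^+ (k != l) * #|[pred u | c u == l]|%:R.
  rewrite mxE -sumr_const mulr_sumr [RHS]big_mkcond /=.
  rewrite [RHS](reindex (@enum_val T T)) /=; last by exists enum_rank => u _;
    rewrite ?enum_valK ?enum_rankK.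
  apply: eq_bigr => i _; rewrite MUE mxE inE; case: (c _ =P l) => [->|_] /=;
    last by rewrite mulr0n mulr0.
  by rewrite mulr1n mulr1 -mulrA -signr_addb addbb mulr1.
rewrite det_scalar_sub_mulmxC; congr (_ * _).
have cardE : #|T| = (\sum_(i < 3) #|[pred u | c u == i]|)%N.
  exact: card_sum_fibers.
pose m (k : nat) := #|[pred u | c u == k :> nat]|.
have mE (l : 'I_3) : #|[pred u | c u == l]| = m l by apply: eq_card.
have entE (k l : 'I_3) : (('X + 1)%:M - M *m U^T *m U) k l =
    ('X + 1) *+ (k == l :> nat) - (-1) ^+ (k != l :> nat) * (m l)%:R.
  by rewrite mxE [X in X + _]mxE [X in _ + X]mxE MUU mE.
rewrite det_mx33 !entE cardE !big_ord_recl !big_ord0 !mE /= /bump /=.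
rewrite !addnA !muln1 !addn0 !natrM !natrD.
by rewrite !mulr1n !mulr0n !expr0 !expr1; ring.
Qed.

(** * Structure of graphs with [S + I] of rank at most 3 *)

Lemma tripartition_of_rank (T : finType) (H : sgraph T) :
  (\rank (seidelmx H + 1%:M)%R <= 3)%N -> exists s c, tripartition H s c.
Proof.
set B := seidelmx H + 1%:M => rkB.
have BE u v : B (enum_rank u) (enum_rank v) = (-1) ^+ adj H u v.
  by rewrite mxE seidelmxE !enum_rankK [X in _ + X]mxE subrK.
have [/existsP[t0 /existsP[t1 /existsP[t2 odd_t]]]|] :=
  boolP [exists x, exists y, exists z, adj H x y (+) adj H y z (+) adj H x z];
  last first.
  (* With all triples even, switching along the neighbourhood of any vertex empties the graph, so a
     single fiber suffices. *)
  move=> /existsPn even_t; case: (pickP (xpredT : pred T)) => [t0 _|T0];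
    last first.
    by exists xpred0, (fun=> 0) => u; have := T0 u.
  exists (adj H t0), (fun=> 0) => u v; rewrite eqxx addbF.
  have /existsPn/(_ u)/existsPn/(_ v) := even_t t0.
  by case: (adj H u v); case: (adj H t0 u); case: (adj H t0 v).
(* After switching by the signs [e], any two of [t0], [t1], [t2] are adjacent;
   [beta i v] is the corresponding sign of the entry [B (t i) v]. *)
pose t (i : 'I_3) := nth t0 [:: t0; t1; t2] i.
pose e (i : 'I_3) := nth false [:: false; ~~ adj H t0 t1; ~~ adj H t0 t2] i.
pose beta i v := e i (+) adj H (t i) v.
have tE i j : adj H (t i) (t j) = e i (+) e j (+) (i != j).
  rewrite /t /e; move: odd_t.
  case: i j => [[|[|[|//]]] ?] [[|[|[|//]]] ?] /=;
    rewrite ?adj_irr ?(adj_sym H t1 t0) ?(adj_sym H t2 t0) ?(adj_sym H t2 t1)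
    -?val_eqE /=;
  by case: (adj H t0 t1); case: (adj H t1 t2); case: (adj H t0 t2).
pose f i := enum_rank (t i).
(* Up to the signs [e], the minor on the three vertices has 1 on and -1 off the diagonal. Its
   determinant is -4, so these rows already reach the rank bound. *)
have /submxP[D BD] : (B <= rowsub f B)%MS.
  rewrite -(geq_leqif (mxrank_leqif_sup (rowsub_sub f B))) (leq_trans rkB) //.
  pose N := mxsub f f B.
  have NE i j : N i j = (-1) ^+ (e i (+) e j (+) (i != j)) by rewrite mxE BE tE.
  have uN : N \in unitmx.
    rewrite unitmxE unitfE det_mx33 !NE /e /=.
    have n4 : - 4%:R != 0 :> algC by rewrite oppr_eq0 pnatr_eq0.
    case: (adj H t0 t1); case: (adj H t0 t2); rewrite /= ?expr0 ?expr1;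
    by apply: contra_neq n4 => <-; ring.
  rewrite -{1}(mxrank_unit uN) /N mxsubcr; move: (rowsub f B) => R3.
  rewrite -mxrank_tr -[X in (_ <= X)%N]mxrank_tr.
  by rewrite trmx_mxsub mxrankS // rowsub_sub.
have {BD} [x xE] : exists x : T -> 'I_3 -> algC,
    forall u v, (-1) ^+ adj H u v = \sum_i x u i * (-1) ^+ beta i v.
  exists (fun u i => D (enum_rank u) i * (-1) ^+ e i) => u v.
  rewrite -BE BD mxE; apply: eq_bigr => i _.
  by rewrite mxE BE signr_addb mulrA -[D _ _ * _ * _]mulrA -signr_addb addbb
    mulr1.
have xM u j : (-1) ^+ beta j u = \sum_i x u i * (-1) ^+ (i != j).
  rewrite signr_addb adj_sym xE mulr_sumr; apply: eq_bigr => i _.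
  rewrite mulrCA -signr_addb /beta tE; congr (_ * (-1) ^+ _).
  by case: (e i); case: (e j); case: eqP.
pose i0 : 'I_3 := 0; pose i1 : 'I_3 := 1; pose i2 : 'I_3 := 2%:R.
(* [c u] is the index on which the three bits [beta i u] have their minority. *)
pose c u := if beta i1 u == beta i2 u then i0
  else if beta i0 u == beta i2 u then i1 else i2.
pose s u := beta (c u) u.
have sum3 (F : 'I_3 -> algC) : \sum_i F i = F i0 + F i1 + F i2.
  by rewrite !big_ord_recl big_ord0 addr0 addrA; congr (F _ + F _ + F _);
    apply: val_inj.
(* The system [xM] has matrix [2 I - J], whose inverse is [(I - J) / 2]. *)
have xsol u : [/\ x u i0 = - ((-1) ^+ beta i1 u + (-1) ^+ beta i2 u) / 2%:R,
    x u i1 = - ((-1) ^+ beta i0 u + (-1) ^+ beta i2 u) / 2%:R &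
    x u i2 = - ((-1) ^+ beta i0 u + (-1) ^+ beta i1 u) / 2%:R].
  by split; rewrite !xM !sum3 /= !expr0 !expr1; field; rewrite ?pnatr_eq0.
(* Three equal signs would make the diagonal entry at [u] equal to -3 instead of 1. *)
have beta_neq u : ~~ ((beta i0 u == beta i1 u) && (beta i1 u == beta i2 u)).
  apply/negP => /andP[/eqP b01 /eqP b12].
  have := xE u u; have [x0 x1 x2] := xsol u.
  rewrite sum3 x0 x1 x2 adj_irr -{}b12 -{}b01 expr0 => /eqP; apply/negP.
  have n4 : 4%:R != 0 :> algC by rewrite pnatr_eq0.
  apply: contra_neq n4 => E.
  have -> : 4%:R = 3%:R + 1 :> algC by ring.
  rewrite [X in _ + X]E.
  by case: (beta i0 u); rewrite ?expr0 ?expr1; field; rewrite ?pnatr_eq0.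
(* The two majority signs cancel the minority sign in pairs, so [x u] is supported at [c u] and row
   [u] is, up to the sign [s u], the row of [t (c u)]. *)
have adjE u v : adj H u v = s u (+) beta (c u) v.
  apply: (@signr_inj algC).
  rewrite xE sum3 signr_addb /s /c; have [-> -> ->] := xsol u;
    move: (beta_neq u).
  case E0: (beta i0 u); case E1: (beta i1 u); case E2: (beta i2 u) => //= _;
  by rewrite ?(E0, E1, E2) ?expr0 ?expr1; field; rewrite ?pnatr_eq0.
exists s, c => u v; rewrite adjE -addbA; congr (_ (+) _).
(* Among the bits of [v], the one at [c v] is [s v] and the other two are its negation. *)
rewrite /s /c; move: (beta_neq u) (beta_neq v).
case: (beta i0 u); case: (beta i1 u); case: (beta i2 u) => //= _;
by case E0: (beta i0 v); case E1: (beta i1 v); case E2: (beta i2 v) => //= _;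
   rewrite ?(E0, E1, E2).
Qed.

(** * Cospectral mates and switching classes *)

(** Corresponding fibers are matched in the order of their enumerations. *)
Lemma fiberwise_bijection (I : eqType) (T T' : finType) (c : T -> I)
    (c' : T' -> I) :
  #|T| = #|T'| ->
  (forall i, #|[pred u | c u == i]| = #|[pred u | c' u == i]|) ->
  exists2 f : T -> T', bijective f & forall x, c' (f x) = c x.
Proof.
move=> eqT eqc; pose A i := enum [pred u | c u == i];
  pose A' i := enum [pred u | c' u == i].
have [f fP] : exists f : T -> T', forall x,
    c' (f x) = c x /\ index (f x) (A' (c x)) = index x (A (c x)).
  apply: (@fin_all_exists T (fun=> T') (fun x y =>
    c' y = c x /\ index y (A' (c x)) = index x (A (c x)))) => x.
  have x_in : x \in A (c x) by rewrite mem_enum inE.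
  have lt_x : (index x (A (c x)) < size (A' (c x)))%N.
    by rewrite -cardE -eqc cardE index_mem.
  have [y _] : exists y : T', y \in [pred u | c' u == c x].
    by apply/card_gt0P; rewrite cardE (leq_trans _ lt_x).
  exists (nth y (A' (c x)) (index x (A (c x)))); split;
    last by rewrite index_uniq ?enum_uniq.
  by have := mem_nth y lt_x; rewrite mem_enum inE => /eqP.
exists f => [|x]; last by case: (fP x).
apply: inj_card_bij; rewrite ?eqT // => x y fxy.
have [cfx ifx] := fP x; have [cfy ify] := fP y.
have cxy : c x = c y by rewrite -cfx fxy.
have : index x (A (c x)) = index y (A (c x)) by rewrite -ifx fxy cxy ify.
by apply: (index_inj x); rewrite mem_enum inE ?cxy.
Qed.

Lemma same_seidel_spectrumP (T T' : finType) (G : sgraph T) (H : sgraph T') :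
  same_seidel_spectrum G H <-> char_poly (seidelmx G) = char_poly (seidelmx H).
Proof.
have spE (T0 : finType) (G0 : sgraph T0) :
    char_poly (seidelmx G0) = \prod_(z <- seidel_spectrum G0) ('X - z%:P).
  rewrite /seidel_spectrum /spectrum;
    case: closed_field_poly_normal => r /= {1}->.
  by rewrite (monicP (char_poly_monic _)) scale1r.
rewrite !spE; split; last exact: prod_XsubC_eq.
exact: perm_big.
Qed.

Lemma seidelmx_normal (T : finType) (H : sgraph T) : seidelmx H \is normalmx.
Proof.
apply/hermitian_normalmx/realsym_hermsym.
  apply/is_hermitianmxP; rewrite expr0 scale1r; apply/matrixP => i j.
  by rewrite !mxE adj_sym eq_sym.
apply/mxOverP => i j; rewrite seidelmxE rpredB ?rpredX ?rpredN ?rpred1 //.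
exact: realn.
Qed.

Lemma horner_seidel_poly (n k : nat) :
  (('X + 1) ^+ 3 - n%:R * ('X + 1) ^+ 2 + k%:R : {poly algC}).[-1] = k%:R.
Proof.
have X1 : ('X + 1 : {poly algC}).[-1] = 0 by rewrite !hornerE addNr.
rewrite -!polyC_natr hornerD hornerD hornerN horner_exp X1.
rewrite hornerM horner_exp X1 !hornerC.
by rewrite !expr0n mulr0 subr0 add0r.
Qed.

(** The degree gives the order. The cubic factor takes at -1 the value 4 times the product of the
    fiber sizes: being nonzero for [G], it bounds the rank for [H]; compared for both graphs, it
    gives the product. *)
Lemma cospectral_tripartition (T T' : finType) (G : sgraph T) (H : sgraph T')
    (s : T -> bool) (c : T -> 'I_3) :
  tripartition G s c -> (forall i, 0 < #|[pred u | c u == i]|)%N ->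
  same_seidel_spectrum H G ->
  exists s' c', [/\ tripartition H s' c', #|T'| = #|T| &
    (\prod_(i < 3) #|[pred u | c' u == i]| =
     \prod_(i < 3) #|[pred u | c u == i]|)%N].
Proof.
move=> sc c_gt0 /same_seidel_spectrumP chE.
have XE : 'X + 1 = 'X - (-1)%:P :> {poly algC} by rewrite polyCN opprK.
have X0 : 'X + 1 != 0 :> {poly algC} by rewrite XE polyXsubC_eq0.
have cardE : #|T'| = #|T|.
  by have /(congr1 (fun p : {poly algC} => size p)) := chE;
    rewrite !size_char_poly => -[].
have chG := char_poly_seidel sc.
have rk : (\rank (seidelmx H - (-1)%:M)%R <= 3)%N.
  rewrite -chE XE -cardE in chG; apply: normalmx_rank_sub chG;
    first exact: seidelmx_normal.
  rewrite -XE horner_seidel_poly pnatr_eq0 -lt0n muln_gt0 /=.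
  by rewrite prodn_gt0.
have [|s' [c' sc']] := @tripartition_of_rank T' H.
  by move: rk; rewrite raddfN /= opprK.
exists s', c'; split=> //.
have chH := char_poly_seidel sc'; rewrite chE chG cardE in chH.
have /(congr1 (horner^~ (-1))) := mulfI (expf_neq0 _ X0) chH.
by rewrite !horner_seidel_poly => /eqP; rewrite eqr_nat eqn_mul2l /= => /eqP.
Qed.

Definition part (p q r : nat) (x : 'I_p + 'I_q + 'I_r) : 'I_3 :=
  match x with inl (inl _) => 0 | inl (inr _) => 1 | inr _ => 2%:R end.

Lemma tripartition_complete (p q r : nat) :
  tripartition (complete_tripartite p q r) xpred0 (@part p q r).
Proof. by case=> [[]|] ? [[]|]. Qed.

Lemma card_part (p q r : nat) (i : 'I_3) :
  #|[pred x | @part p q r x == i]| = tnth [tuple p; q; r] i.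
Proof.
rewrite -sum1_card big_mkcond !big_sumType /=.
rewrite (tnth_nth 0%N).
case: i => [[|[|[|//]]] ?] /=.
1-3: by rewrite -?val_eqE /= !sum_nat_const !card_ord; lia.
Qed.

(** Switching along [s] leaves the complete tripartite graph on the fibers, and [pi] relabels these
    as the parts. *)
Lemma isomorphic_of_tripartition (T : finType) (H : sgraph T) (s : T -> bool)
    (c : T -> 'I_3) (p q r : nat) :
  tripartition H s c -> #|T| = (p + q + r)%N ->
  perm_eq [seq #|[pred u | c u == i]| | i <- enum 'I_3] [:: p; q; r] ->
  exists2 K : sgraph T, switching_equivalent H K &
    isomorphic K (complete_tripartite p q r).
Proof.
move=> sc cardT /(tuple_permP (t := [tuple p; q; r]))[pi /eq_in_map piE].
have {}piE i : #|[pred u | c u == i]| = tnth [tuple p; q; r] (pi i).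
  by rewrite piE // mem_enum.
have [||f f_bij fE] := @fiberwise_bijection _ T _ (pi \o c) (@part p q r).
- by rewrite cardT !card_sum !card_ord.
- move=> k; rewrite card_part -[in RHS](permKV pi k) -piE; apply: eq_card => u.
  by rewrite !inE /= (canF_eq (permK pi)).
exists (switch H [set u | s u]); first by exists [set u | s u].
exists f => // x y; rewrite tripartition_complete /= !fE (inj_eq perm_inj).
rewrite /switch_rel !inE sc.
by case: (s x); case: (s y); case: eqP.
Qed.

(** Switching keeps the parity of the number of edges in a triple. A triple with two vertices in one
    fiber is even; if their images lay in different fibers, a vertex over the third would make it
    odd. *)
Lemma switching_isomorphic_fibers (T T' : finType) (G : sgraph T)
    (H : sgraph T') (s : T -> bool) (c : T -> 'I_3) (s' : T' -> bool) (c' : T' -> 'I_3)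
    (K : sgraph T) :
  tripartition G s c -> tripartition H s' c' ->
  switching_equivalent G K -> isomorphic K H ->
  (forall i, exists u, c' u = i) ->
  exists2 f : T -> T', bijective f &
    forall x y, c x = c y -> c' (f x) = c' (f y).
Proof.
move=> sc sc' [U KU] [f fbij KH] surj; exists f => // x y cxy.
have [g fK gK] := fbij.
apply/eqP; apply/negPn/negP => ncf.
have [w' [nx ny]] : exists w', c' w' != c' (f x) /\ c' w' != c' (f y).
  have : exists k, k != c' (f x) /\ k != c' (f y).
    move: ncf; case: (c' (f x)) (c' (f y))
      => [[|[|[|//]]] ?] [[|[|[|//]]] ?] // _;
    by [exists 0 | exists 1 | exists 2%:R].
  by case=> k; have [w <-] := surj k; exists w.
rewrite -(gK w') in nx ny; move: (g w') => w in nx ny.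
have KE u v : adj K u v =
    (u \in U) (+) (v \in U) (+) s u (+) s v (+) (c u != c v).
  by rewrite KU /= /switch_rel sc; case: (u \in U); case: (v \in U);
    case: (s u); case: (s v); case: (c u == c v).
have := KH x w; have := KH y w; have := KH x y.
rewrite !KE !sc' cxy eqxx ncf ![_ == c' (f w)]eq_sym nx ny.
by case: (x \in U); case: (y \in U); case: (w \in U); case: (s x); case: (s y);
  case: (s w); case: (c y == c w);
  case: (s' (f x)); case: (s' (f y)); case: (s' (f w)).
Qed.

(** * The exceptional pair *)

(** The mate has the same sum 14 and product 72, but its part of size 8 would inject into a part of
    size at most 6. *)
Lemma K662_not_S_determined : ~ S_determined (complete_tripartite 6 6 2).
Proof.
move=> det; have [] := det _ (complete_tripartite 3 3 8).
  apply/same_seidel_spectrumP.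
  have X0 : 'X + 1 != 0 :> {poly algC}
    by rewrite -[1]opprK -polyC1 -polyCN polyXsubC_eq0.
  apply: (mulfI (expf_neq0 3 X0)).
  rewrite !(char_poly_seidel (@tripartition_complete _ _ _)) !card_sum
    !card_ord.
  by rewrite !big_ord_recl !big_ord0 !card_part.
move=> K swK isoK.
have surj : forall i, exists u, @part 6 6 2 u = i.
  case=> [[|[|[|//]]] ?];
    [exists (inl (inl ord0))|exists (inl (inr ord0))|exists (inr ord0)];
  exact: val_inj.
have [f /bij_inj f_inj fE] :=
  switching_isomorphic_fibers (@tripartition_complete 3 3 8)
    (@tripartition_complete 6 6 2) swK isoK surj.
pose k := part (f (inr ord0)).
have : (8 <= #|[pred x | @part 6 6 2 x == k]|)%N.
  rewrite -[8%N]card_ord -(card_imset predT (f := fun i : 'I_8 => f (inr i)));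
    last first.
    by move=> i j /f_inj[].
  apply/subset_leq_card/subsetP => _ /imsetP[i _ ->].
  by rewrite inE; apply/eqP; apply: fE.
by rewrite card_part (tnth_nth 0%N); case: k => [[|[|[|//]]] ?].
Qed.

End SeidelSpectrum.

(** * Part sizes with prescribed sum and product *)

(** By coprimality, [x] is the product of its gcds with [a ^ m] and [b ^ n]. *)
Lemma dvdn_pfactor2 (a b m n x : nat) : prime a -> prime b -> a <> b ->
  x %| a ^ m * b ^ n -> exists i j, x = a ^ i * b ^ j.
Proof.
move=> pa pb /eqP nab xd.
have co : coprime (a ^ m) (b ^ n).
  by rewrite coprimeXl ?coprimeXr // prime_coprime // dvdn_prime2.
have /(dvdn_pfactor _ _ pa)[i _ Di] := dvdn_gcdr x (a ^ m).
have /(dvdn_pfactor _ _ pb)[j _ Dj] := dvdn_gcdr x (b ^ n).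
exists i, j; rewrite -Di -Dj; apply/eqP; rewrite eqn_dvd; apply/andP; split.
  rewrite muln_gcdl dvdn_gcd dvdn_mulr //= muln_gcdr dvdn_gcd xd andbT.
  exact: dvdn_mull.
rewrite Gauss_dvd ?dvdn_gcdl //.
by apply: coprime_dvdl (dvdn_gcdr _ _) _;
  apply: coprime_dvdr (dvdn_gcdr _ _) co.
Qed.

Lemma sorted_sum_prod_unique (a b i1 i2 i3 j1 j2 j3 : nat) :
  prime a -> prime b -> a <> b -> (a, b) <> (2, 3) ->
  i3 <= i2 <= i1 -> i1 + i2 + i3 = 3 -> j1 + j2 + j3 = 2 ->
  a ^ i1 * b ^ j1 + a ^ i2 * b ^ j2 + a ^ i3 * b ^ j3 = a * b + a * b + a ->
  perm_eq [:: a ^ i1 * b ^ j1; a ^ i2 * b ^ j2; a ^ i3 * b ^ j3]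
          [:: a * b; a * b; a].
Proof.
move=> pa pb nab n23 /andP[le32 le21] iE jE sumE.
have a_gt1 := prime_gt1 pa; have b_gt1 := prime_gt1 pb.
have ndvd j : ~~ (a %| b ^ j).
  by rewrite -prime_coprime // coprimeXr // prime_coprime // dvdn_prime2 //;
    apply/eqP.
have [[? [? ?]]|[[? [? ?]]|[? [? ?]]]] :
    i1 = 3 /\ i2 = 0 /\ i3 = 0 \/ i1 = 2 /\ i2 = 1 /\ i3 = 0 \/
    i1 = 1 /\ i2 = 1 /\ i3 = 1 by lia.
- subst; exfalso; move: sumE; rewrite expn0 !mul1n.
  have jcases : j1 = 0 /\ j2 = 1 /\ j3 = 1 \/ j1 = 0 /\ j2 = 2 /\ j3 = 0 \/
    j1 = 0 /\ j2 = 0 /\ j3 = 2 \/ 0 < j1 by lia.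
  case: jcases => [[-> [-> ->]]|[[-> [-> ->]]|[[-> [-> ->]]|j1_gt0]]].
  + rewrite !expnS !expn0 => sumE.
    have bE : a * (a + 1) = 2 * b by nia.
    have : a %| 2 * b by rewrite -bE dvdn_mulr.
    rewrite Euclid_dvdM // !dvdn_prime2 // => /orP[] /eqP // a2.
    by apply: n23; subst; congr pair; lia.
  (* In this case and the next, the left side exceeds the right by
     [(b - a)^2 + (a - 1)^2 (a + 1) > 0]. *)
  + by rewrite !expnS !expn0; nia.
  + by rewrite !expnS !expn0; nia.
  (* The first term is at least [a^3 b >= 4 a b], more than the whole sum. *)
  + move=> sumE; have : b ^ 1 <= b ^ j1 by rewrite leq_exp2l.
    rewrite expn1 !expnS expn0 in sumE * => le_b.
    have : a * (a * (a * 1)) * b <= a * b + a * b + a.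
      by rewrite -sumE -addnA; apply: leq_trans (leq_addr _ _);
        rewrite leq_mul2l le_b orbT.
    have : 4 * (a * b) <= a * a * (a * b).
      by rewrite leq_mul2r; apply/orP; right; nia.
    nia.
(* Modulo [a] only the term [b ^ j3] survives. *)
- subst; case/negP: (ndvd j3); have : a %| a * b + a * b + a.
    by rewrite !dvdn_addr ?dvdn_mulr.
  by rewrite -sumE expn0 mul1n dvdn_addr //; apply: dvdn_add;
    apply/dvdn_mulr/dvdn_exp.
(* After division by [a], exponents 2, 0, 0 in any order would give [(b - 1)^2 = 0]. *)
- subst; have {}sumE : b ^ j1 + b ^ j2 + b ^ j3 = b + b + 1.
    by apply/eqP; rewrite -(eqn_pmul2l (ltnW a_gt1)); apply/eqP;
      rewrite expn1 in sumE; lia.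
  have jcases : j1 = 1 /\ j2 = 1 /\ j3 = 0 \/ j1 = 1 /\ j2 = 0 /\ j3 = 1 \/
      j1 = 0 /\ j2 = 1 /\ j3 = 1 \/
      j1 = 2 /\ j2 = 0 /\ j3 = 0 \/ j1 = 0 /\ j2 = 2 /\ j3 = 0 \/
      j1 = 0 /\ j2 = 0 /\ j3 = 2 by lia.
  move: jcases sumE.
  case=> [[-> [-> ->]]|[[-> [-> ->]]|[[-> [-> ->]]|[[-> [-> ->]]|
    [[-> [-> ->]]|[-> [-> ->]]]]]]]; rewrite !expnS !expn0 !muln1; try nia; move=> _.
  + by [].
  + by rewrite perm_cons (perm_catC [:: _] [:: _]).
  + by rewrite (perm_catC [:: _] [:: _; _]).
Qed.

Lemma sum_prod_unique (a b x y z : nat) : prime a -> prime b -> a <> b ->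
  (a, b) <> (2, 3) ->
  x + y + z = a * b + a * b + a -> x * y * z = a * b * (a * b) * a ->
  perm_eq [:: x; y; z] [:: a * b; a * b; a].
Proof.
move=> pa pb nab n23 sumE prodE.
have prodE' : x * y * z = a ^ 3 * b ^ 2 by rewrite prodE !expnS !expn0; lia.
have factor u : u %| x * y * z -> exists i j, u = a ^ i * b ^ j.
  by rewrite prodE'; apply: dvdn_pfactor2.
have [i1 [j1 xE]] : exists i j, x = a ^ i * b ^ j.
  by apply: factor; rewrite -mulnA dvdn_mulr.
have [i2 [j2 yE]] : exists i j, y = a ^ i * b ^ j.
  by apply: factor; rewrite mulnAC dvdn_mull.
have [i3 [j3 zE]] : exists i j, z = a ^ i * b ^ j.
  by apply: factor; rewrite dvdn_mull.
have powE : a ^ (i1 + i2 + i3) * b ^ (j1 + j2 + j3) = a ^ 3 * b ^ 2.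
  by rewrite -prodE' xE yE zE !expnD; lia.
have logE (i j p : nat) : p \in [:: a; b] ->
    logn p (a ^ i * b ^ j) = (p == a) * i + (p == b) * j.
  rewrite !inE => /pred2P pE.
  rewrite lognM ?expn_gt0 ?prime_gt0 // !lognX !logn_prime //.
  by rewrite ![_ * nat_of_bool _]mulnC.
have iE : i1 + i2 + i3 = 3.
  have /(congr1 (logn a)) := powE; rewrite !logE ?inE ?eqxx //.
  by move/eqP/negPf: nab ->; rewrite !mul0n !addn0 !mul1n.
have jE : j1 + j2 + j3 = 2.
  have /(congr1 (logn b)) := powE; rewrite !logE ?inE ?eqxx ?orbT //.
  by move/eqP/negPf: nab; rewrite eq_sym => ->; rewrite !mul0n !add0n !mul1n.
rewrite xE yE zE in sumE *; clear xE yE zE factor powE prodE prodE' logE.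
have core := @sorted_sum_prod_unique a b _ _ _ _ _ _ pa pb nab n23.
(* The terms are reordered by decreasing exponent of [a]; a cyclic pattern of inequalities forces
   equal exponents. *)
have [le21|/ltnW le12] := leqP i2 i1; have [le32|/ltnW le23] := leqP i3 i2;
  have [le31|/ltnW le13] := leqP i3 i1.
- by apply: core; rewrite ?le21 ?le32.
- by apply: core; rewrite ?le21 ?le32.
- apply: perm_trans (core i1 i3 i2 j1 j3 j2 _ _ _ _); try lia.
  by rewrite perm_cons (perm_catC [:: _] [:: _]).
- apply: perm_trans (core i3 i1 i2 j3 j1 j2 _ _ _ _); try lia.
  by rewrite (perm_catC [:: _; _] [:: _]).
- apply: perm_trans (core i2 i1 i3 j2 j1 j3 _ _ _ _); try lia.
  by rewrite (perm_catCA [:: _] [:: _] [:: _]).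
- apply: perm_trans (core i2 i3 i1 j2 j3 j1 _ _ _ _); try lia.
  by rewrite (perm_catC [:: _] [:: _; _]).
- apply: perm_trans (core i3 i2 i1 j3 j2 j1 _ _ _ _); try lia.
  by rewrite -[X in perm_eq _ X]revK perm_sym perm_rev.
- apply: perm_trans (core i3 i2 i1 j3 j2 j1 _ _ _ _); try lia.
  by rewrite -[X in perm_eq _ X]revK perm_sym perm_rev.
Qed.

(** * Assembling the equivalence *)

Theorem theorem4p6 (a b : nat) (pr_a : prime a) (pr_b : prime b)
    (neq_ab : a <> b) :
  S_determined (complete_tripartite (a * b) (a * b) a) <-> (a, b) <> (2, 3).
Proof.
split=> [det [a2 b3]|n23 T H cosp].
  by move: det; rewrite a2 b3; apply: K662_not_S_determined.
have a_gt0 := prime_gt0 pr_a; have b_gt0 := prime_gt0 pr_b.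
have [|s [c [sc cardT prodE]]] :=
  cospectral_tripartition (@tripartition_complete (a * b) (a * b) a) _ cosp.
  move=> i; rewrite card_part (tnth_nth 0).
  by case: i => [[|[|[|//]]] ?] /=; rewrite ?muln_gt0 ?a_gt0 ?b_gt0.
apply: (isomorphic_of_tripartition sc);
  first by rewrite cardT !card_sum !card_ord.
have sumE := card_sum_fibers c.
rewrite cardT !card_sum !card_ord !big_ord_recl !big_ord0 addn0 addnA in sumE.
rewrite !big_ord_recl !big_ord0 !card_part !(tnth_nth 0) !muln1 !mulnA /= in
  prodE.
rewrite !enum_ordSl !(map_cons, enum_ord0) /=.
by apply: sum_prod_unique; rewrite // prodE !mulnA.
Qed.
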